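(* Let $S$ be a finitely presented semigroup and let $R$ be an $\mathscr R$-class of $S$ containing only finitely many $\mathscr H$-classes. Suppose that there exists $s\in R$ such that the right stabilizer $\mathrm{St}(s)=\{t\in S\mid st=s\}$ admits no non-trivial homomorphism into a group. Then the Schützenberger group of $R$ is finitely presented.
   Context: $S^1$ denotes $S$ with an identity adjoined. Green's relations: $s\mathrel{\mathscr R}t$ iff $sS^1=tS^1$; $s\mathrel{\mathscr L}t$ iff $S^1s=S^1t$; $\mathscr H=\mathscr L\cap\mathscr R$. For an $\mathscr R$-class $R$, let $\mathrm{St}(R)=\{s\in S^1\mid sR\subseteq R\}$, acting on $R$ by left multiplication. The quotient of $\mathrm{St}(R)$ by its action on $R$ (identify $s,t\in\mathrm{St}(R)$ when $sr=tr$ for all $r\in R$) is a group $G(R)$ acting on $R$ without fixed points; it is called the Schützenberger group of $R$. The orbits of $G(R)$ on $R$ are exactly the $\mathscr H$-classes contained in $R$. A semigroup homomorphism is called trivial if its image has cardinality at most $1$; $\mathrm{St}(s)$ is a (possibly empty) subsemigroup of $S$, and if it is empty it admits no non-trivial homomorphism into a group. *)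

(* Defs.v *)
From HB Require Import structures.
From mathcomp Require Import all_boot.
From mathcomp Require Import boolp classical_sets cardinality.

Set Implicit Arguments.
Unset Strict Implicit.
Unset Printing Implicit Defensive.

Local Open Scope classical_set_scope.
Local Open Scope group_scope.

(* An identity [None] is adjoined even when S already has one.  This changes
   neither Green's relations nor the Schutzenberger group. *)
Definition adj1 (S : Type) := option S.

Section Adj1.
Variable S : semigroupType.
Implicit Types x y z : adj1 S.

HB.instance Definition _ := Choice.copy (adj1 S) (option S).

Definition adj1_mul x y : adj1 S :=
  match x, y with
  | Some s, Some t => Some (s * t)
  | None, _ => y
  | _, None => x
  end.

Lemma adj1_mulA : associative adj1_mul.
Proof. by case=> [x|] [y|] [z|] //=; rewrite mulgA. Qed.

Lemma adj1_mul1 : left_id None adj1_mul. Proof. by []. Qed.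

Lemma adj1_mulr1 : right_id None adj1_mul. Proof. by case. Qed.

HB.instance Definition _ :=
  isMonoid.Build (adj1 S) adj1_mulA adj1_mul1 adj1_mulr1.

End Adj1.

Definition to1 (S : semigroupType) (s : S) : adj1 S := Some s.

Section Green.
Variable S : semigroupType.
Implicit Types (s t : S) (R : set S).

Definition greenR s t : Prop :=
  range (fun x : adj1 S => to1 s * x) = range (fun x : adj1 S => to1 t * x).

Definition greenL s t : Prop :=
  range (fun x : adj1 S => x * to1 s) = range (fun x : adj1 S => x * to1 t).

Definition greenH s t : Prop := greenL s t /\ greenR s t.

Definition is_Rclass R : Prop := exists s, R = [set t | greenR s t].

Definition Hclasses_in R : set (set S) :=
  [set H | exists2 s, R s & H = [set t | greenH s t]].

End Green.

Section Stabilizer.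
Variables (S : semigroupType) (R : set S).

Definition stab : {pred adj1 S} :=
  [pred x | `[< [set x * r | r in @to1 S @` R] `<=` @to1 S @` R >]].

Lemma stabP (x : adj1 S) :
  reflect (forall r, R r -> exists2 r', R r' & x * to1 r = to1 r') (x \in stab).
Proof.
apply: (iffP (asboolP _)) => [sx r Rr|sx _ [_ [r Rr <-] <-]].
  have [r' Rr' e] : (@to1 S @` R) (x * to1 r) by apply: sx; exists (to1 r) => //; exists r.
  by exists r'.
by have [r' Rr' ->] := sx r Rr; exists r'.
Qed.

Lemma stab_monoid_closed : monoid_closed stab.
Proof.
split=> [|x y /stabP sx /stabP sy]; first by apply/stabP => r Rr; exists r.
apply/stabP => r Rr; have [r1 Rr1 e1] := sy r Rr; have [r2 Rr2 e2] := sx r1 Rr1.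
by exists r2 => //; rewrite -mulgA e1.
Qed.

Definition St := {x : adj1 S | x \in stab}.

HB.instance Definition _ := SubChoice.on St.
HB.instance Definition _ :=
  SubChoice_isSubMonoid.Build (adj1 S) (mem stab) St stab_monoid_closed.

Definition same_action : rel St :=
  fun s t => `[< forall r, R r -> val s * to1 r = val t * to1 r >].

Lemma same_action_refl : reflexive same_action.
Proof. by move=> s; apply/asboolP. Qed.

Lemma same_action_sym : symmetric same_action.
Proof. by move=> s t; apply/asboolP/asboolP => e r Rr; rewrite e. Qed.

Lemma same_action_trans : transitive same_action.
Proof. by move=> t s u /asboolP e /asboolP f; apply/asboolP => r Rr; rewrite e// f. Qed.

Canonical same_action_equiv :=
  EquivRel same_action same_action_refl same_action_sym same_action_trans.

(* For an arbitrary R-class this quotient is only a monoid: for the R-class of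
   the identity of the bicyclic monoid it is the free monoid on one generator. *)
Definition schutz_monoid := {eq_quot same_action}%qT.

HB.instance Definition _ := Choice.on schutz_monoid.
HB.instance Definition _ := EqQuotient.on schutz_monoid.

Local Open Scope quotient_scope.

Definition schutz_mul (x y : schutz_monoid) : schutz_monoid :=
  \pi_schutz_monoid (repr x * repr y).

Definition schutz_one : schutz_monoid := \pi_schutz_monoid 1.

Lemma piP (s t : St) :
  reflect (forall r, R r -> val s * to1 r = val t * to1 r)
          (\pi_schutz_monoid s == \pi_schutz_monoid t).
Proof. by rewrite eqmodE; apply: asboolP. Qed.

Lemma repr_pi (s : St) r : R r ->
  val (repr (\pi_schutz_monoid s)) * to1 r = val s * to1 r.
Proof. by move: r; apply/(piP (repr (\pi_schutz_monoid s)) s)/eqP; exact: reprK. Qed.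

Lemma piM (s t : St) :
  schutz_mul (\pi_schutz_monoid s) (\pi_schutz_monoid t) = \pi_schutz_monoid (s * t).
Proof.
apply/eqP/piP => r Rr; rewrite !gmulfM -!mulgA repr_pi//.
by have /stabP/(_ r Rr)[r' Rr' ->] := valP t; rewrite repr_pi.
Qed.

Lemma schutz_mulA : associative schutz_mul.
Proof. by move=> x y z; rewrite -[x]reprK -[y]reprK -[z]reprK !piM !reprK mulgA. Qed.

Lemma schutz_mul1 : left_id schutz_one schutz_mul.
Proof. by move=> x; rewrite -[x]reprK piM mul1g. Qed.

Lemma schutz_mulr1 : right_id schutz_one schutz_mul.
Proof. by move=> x; rewrite -[x]reprK piM mulg1. Qed.

HB.instance Definition _ :=
  isMonoid.Build schutz_monoid schutz_mulA schutz_mul1 schutz_mulr1.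

End Stabilizer.

Section SchutzGroup.
Variables (S : semigroupType) (R : set S).
Hypotheses (hR : is_Rclass R) (hfin : finite_set (Hclasses_in R)).

Local Open Scope quotient_scope.

Lemma greenRP (s t : S) : greenR s t <->
  (exists a : adj1 S, to1 s = to1 t * a) /\ (exists b : adj1 S, to1 t = to1 s * b).
Proof.
split=> [e|[[a ea] [b eb]]].
  split.
    have : range (fun x : adj1 S => to1 s * x) (to1 s) by exists 1; rewrite ?mulg1.
    by rewrite e => -[a _ <-]; exists a.
  have : range (fun x : adj1 S => to1 t * x) (to1 t) by exists 1; rewrite ?mulg1.
  by rewrite -e => -[a _ <-]; exists a.
apply/seteqP; split=> _ [x _ <-].
  by exists (a * x) => //; rewrite mulgA -ea.
by exists (b * x) => //; rewrite mulgA -eb.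
Qed.

Lemma RclassP (r t : S) : R r -> R t <->
  (exists a : adj1 S, to1 r = to1 t * a) /\ (exists b : adj1 S, to1 t = to1 r * b).
Proof.
case: hR => s -> /= sr; rewrite -greenRP.
by split; rewrite /greenR /= => e; [rewrite -sr | rewrite sr].
Qed.

Lemma stab_left_inv (x : St R) : exists y : St R, forall r, R r ->
  val y * (val x * to1 r) = to1 r.
Proof.
have [s0 Rs0] : exists s, R s by case: hR => s ->; exists s.
have stx n : forall r, R r -> exists2 r', R r' & val x ^+ n * to1 r = to1 r'.
  apply/stabP; elim: n => [|n IH]; first exact: (stab_monoid_closed R).1.
  by rewrite expgS; apply: (stab_monoid_closed R).2 => //; apply: valP.
pose rn n := sval (cid2 (stx n s0 Rs0)).
have rnR n : R (rn n) by rewrite /rn; case: cid2.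
have rnE n : to1 (rn n) = val x ^+ n * to1 s0 by rewrite /rn; case: cid2.
pose Hn n := [set t | greenH (rn n) t].
(* two of the elements x^n s0 lie in the same H-class, by the pigeonhole principle *)
have [i [k eH]] : exists i k, Hn i = Hn (i + k.+1)%N.
  apply: contrapT => nex.
  have injH : injective Hn.
    move=> i j e; case: (ltngtP i j) => // lt; exfalso; apply: nex.
      by exists i, (j - i.+1)%N; rewrite addnS -addSn subnKC.
    by exists j, (i - j.+1)%N; rewrite addnS -addSn subnKC.
  have : finite_set (range Hn).
    by apply: sub_finite_set hfin => _ [n _ <-]; exists (rn n).
  by rewrite (eq_finite_set (inj_card_eq (in2W injH))); exact: infinite_nat.
have [t tE] : exists t : adj1 S, to1 (rn i) = t * to1 (rn (i + k.+1)%N).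
  have : Hn (i + k.+1)%N (rn i) by rewrite -eH.
  case=> eL _.
  have : range (fun x : adj1 S => x * to1 (rn i)) (to1 (rn i)) by exists 1; rewrite ?mul1g.
  by rewrite -eL => -[t _ <-]; exists t.
have [[a ea] [b eb]] := (RclassP _ Rs0).1 (rnR i).
pose u := t * val x ^+ k.
have us0 : u * (val x * to1 s0) = to1 s0.
  have key : u * (val x * to1 (rn i)) = to1 (rn i).
    rewrite {2}tE /u !rnE -!mulgA; congr (_ * _).
    by rewrite !mulgA -expgSr -expgnDr addnC.
  by rewrite ea !mulgA -[u * _ * _]mulgA key.
have uR r : R r -> u * (val x * to1 r) = to1 r.
  by move=> /(RclassP _ Rs0).1[_ [c ->]]; rewrite !mulgA -[u * _ * _]mulgA us0.
have uS : u \in stab R.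
  apply/stabP => r Rr.
  have [r1 Rr1 e1] := (stabP _ _ (valP x)) s0 Rs0.
  have [[c ec] [d ed]] := (RclassP _ Rr1).1 Rr.
  have e2 : u * to1 r = to1 s0 * d by rewrite ed -e1 !mulgA -[u * _ * _]mulgA us0.
  have [v ve] : exists v, to1 v = to1 s0 * d by case: (d) => [d'|]; [exists (s0 * d')|exists s0].
  exists v; last by rewrite e2 ve.
  apply/(RclassP _ Rs0); split; last by exists d.
  by exists c; rewrite ve -e2 -mulgA -ec -e1 us0.
by exists (exist _ u uS).
Qed.

(* The Schutzenberger group G(R); [hfin] is what makes the quotient a group. *)
Definition schutz_group of is_Rclass R & finite_set (Hclasses_in R) :=
  schutz_monoid R.

Local Notation G := (schutz_group hR hfin).

HB.instance Definition _ := Monoid.copy G (schutz_monoid R).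

Lemma schutz_left_inv (x : G) : exists y : G, y * x = 1.
Proof.
have [y yP] := stab_left_inv (repr (x : schutz_monoid R)).
exists (\pi_(schutz_monoid R) y); rewrite -[x](@reprK _ (schutz_monoid R)).
rewrite [LHS]piM; apply/eqP/piP => r Rr.
by rewrite gmulfM -mulgA yP.
Qed.

Definition schutz_inv (x : G) : G := sval (cid (schutz_left_inv x)).

Lemma schutz_mulVg : left_inverse 1 schutz_inv *%g.
Proof. by move=> x; rewrite /schutz_inv; case: cid. Qed.

Lemma schutz_mulgV : right_inverse 1 schutz_inv *%g.
Proof.
move=> x; rewrite -[LHS]mul1g -[X in X * _](schutz_mulVg (schutz_inv x)).
by rewrite -mulgA [schutz_inv x * (_ * _)]mulgA schutz_mulVg mul1g schutz_mulVg.
Qed.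

HB.instance Definition _ := hasInv.Build G schutz_inv.
HB.instance Definition _ := Monoid_isGroup.Build G schutz_mulVg schutz_mulgV.

End SchutzGroup.

Section RightStabilizer.
Variables (S : semigroupType) (s : S).

Definition rstab : {pred S} := [pred t | s * t == s].

Lemma rstab_mulg_closed : mulg_closed rstab.
Proof. by move=> t u /eqP et /eqP eu; apply/eqP; rewrite mulgA et. Qed.

Definition Str := {t : S | t \in rstab}.

HB.instance Definition _ := SubChoice.on Str.
HB.instance Definition _ :=
  SubChoice_isSubSemigroup.Build S (mem rstab) Str rstab_mulg_closed.

End RightStabilizer.

Definition no_nontrivial_hom_to_group (T : semigroupType) : Prop :=
  forall (G : groupType) (f : {multiplicative T -> G}), is_subset1 (range f).

Inductive gen_cong (F : semigroupType) (rho : F -> F -> Prop) : F -> F -> Prop :=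
| GenCong_base u v : rho u v -> gen_cong rho u v
| GenCong_refl u : gen_cong rho u u
| GenCong_sym u v : gen_cong rho u v -> gen_cong rho v u
| GenCong_trans u v w : gen_cong rho u v -> gen_cong rho v w -> gen_cong rho u w
| GenCong_mul u u' v v' :
    gen_cong rho u u' -> gen_cong rho v v' -> gen_cong rho (u * v) (u' * v').

(* f induces an isomorphism from the quotient of F by the congruence generated
   by rho onto T. *)
Definition induces_iso (F T : semigroupType) (rho : F -> F -> Prop)
    (f : {multiplicative F -> T}) : Prop :=
  range f = setT /\ forall u v, f u = f v <-> gen_cong rho u v.

Definition free_monoid (A : Type) := seq A.

HB.instance Definition _ (A : choiceType) := Choice.copy (free_monoid A) (seq A).
HB.instance Definition _ (A : choiceType) :=
  isMonoid.Build (free_monoid A) (@catA A) (@cat0s A) (@cats0 A).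

Definition nonempty_word (A : choiceType) : {pred free_monoid A} :=
  [pred w | (w : seq A) != [::]].

Lemma nonempty_word_closed (A : choiceType) : mulg_closed (@nonempty_word A).
Proof. by case=> [|a u] // v. Qed.

Definition free_semigroup (A : choiceType) :=
  {w : free_monoid A | w \in @nonempty_word A}.

HB.instance Definition _ (A : choiceType) := SubChoice.on (free_semigroup A).
HB.instance Definition _ (A : choiceType) :=
  SubChoice_isSubSemigroup.Build (free_monoid A) (mem (@nonempty_word A))
    (free_semigroup A) (@nonempty_word_closed A).

Definition fp_semigroup (S : semigroupType) : Prop :=
  exists (n : nat) (rels : seq (free_semigroup 'I_n * free_semigroup 'I_n))
         (f : {multiplicative free_semigroup 'I_n -> S}),
    induces_iso (fun u v => (u, v) \in rels) f.

(* Group words: (i, true) is the i-th generator, (i, false) its formal inverse. *)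
Definition group_word (n : nat) := free_monoid ('I_n * bool)%type.

HB.instance Definition _ n := Monoid.on (group_word n).

Definition letter n (i : 'I_n) (b : bool) : group_word n := [:: (i, b)].

Variant group_rel n (rels : seq (group_word n * group_word n)) :
    group_word n -> group_word n -> Prop :=
| GroupRel_given u v : (u, v) \in rels -> group_rel rels u v
| GroupRel_inv i b : group_rel rels (letter i b * letter i (~~ b)) 1.

Definition fp_group (G : groupType) : Prop :=
  exists (n : nat) (rels : seq (group_word n * group_word n))
         (f : {multiplicative group_word n -> G}),
    induces_iso (group_rel rels) f.

(* Main.v *)
Require Import Defs.
From HB Require Import structures.
From mathcomp Require Import all_boot.
From mathcomp Require Import boolp classical_sets cardinality.

(** The argument is a covering space argument.  Let [A] be a finite generating
    set of [S].  The Schutzenberger graph of [R] has vertex set [R] and an edge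
    from [r] to [ra] whenever [a] is in [A] and [ra] is still in [R]; it is
    strongly connected.  Glue a 2-cell along the two paths from [r] labelled [u]
    and [v] for each defining relation [u = v] of [S] and each [r] such that
    [ru] is in [R].  The group [G(R)] acts freely on this complex, and the
    orbits on vertices are the H-classes in [R], so the quotient is a finite
    complex and has a finitely presented fundamental group [P].

    The complex is simply connected.  Two words with the same value in [S] label
    homotopic paths, so reading labels is a homomorphism from [St(s)] to the
    fundamental group of the complex at [s], and that homomorphism is trivial by
    assumption: directed loops at [s] are null-homotopic.  In a strongly
    connected graph the directed loops generate the fundamental group.  Hence
    the complex is the universal cover of its quotient, and [P] is [G(R)].

    No topology is needed to carry this out.  [presentation] is the
    presentation of [P] read off the quotient complex: its generators are pairs
    of an orbit and a letter, its relators come from the 2-cells and from paths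
    joining the base point to each orbit.  Sending an edge to the element of
    [G(R)] that compares the end of its lift to the chosen orbit representative
    defines a map from [P] to [G(R)], which is path lifting ([coef_path]).  It
    is injective because directed loops at [s] are trivial in [P] ([pi_loop]),
    hence the class of a directed path from [s] depends only on its end point
    ([pi_path_end]), while every element of [P] is the class of a directed path
    from [s] to the corresponding translate of [s] ([represents_ex]). *)

Set Implicit Arguments.
Unset Strict Implicit.
Unset Printing Implicit Defensive.

Local Open Scope classical_set_scope.
Local Open Scope group_scope.
Local Open Scope quotient_scope.

(** * Groups given by generators and relations *)

Section WordEval.
Variables (n : nat) (G : groupType) (c : 'I_n -> G).

Definition letter_eval (ib : 'I_n * bool) : G :=
  if ib.2 then c ib.1 else (c ib.1)^-1.

Definition word_eval (w : group_word n) : G :=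
  foldr (fun ib z => letter_eval ib * z) 1 w.

Lemma word_evalM (u v : group_word n) :
  word_eval (u * v) = word_eval u * word_eval v.
Proof.
elim: u => [|i u IH]; first by rewrite -[[::]]/(1 : group_word n) !mul1g.
by rewrite /= -mulgA -IH.
Qed.

HB.instance Definition _ :=
  isMultiplicative.Build (group_word n) G word_eval word_evalM.

Lemma word_eval_letter i b : word_eval (letter i b) = letter_eval (i, b).
Proof. exact: mulg1. Qed.

(** Von Dyck's theorem. *)
Lemma word_eval_cong (rels : seq (group_word n * group_word n)) u v :
    (forall u v, (u, v) \in rels -> word_eval u = word_eval v) ->
  gen_cong (group_rel rels) u v -> word_eval u = word_eval v.
Proof.
move=> relP; elim=> {u v} [u v [{}u {}v /relP //|i b]| | | |] //.
- by rewrite word_evalM !word_eval_letter /letter_eval; case: b; rewrite /= ?mulgV ?mulVg.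
- by move=> u v w _ -> _.
- by move=> u u' v v' _ eu _ ev; rewrite !word_evalM eu ev.
Qed.

End WordEval.

(** The group defined by a presentation has to exist as an object: it will be
    the target of a homomorphism defined on a right stabilizer. *)
Section PresentedGroup.
Variables (n : nat) (rels : seq (group_word n * group_word n)).

Definition presented_rel : rel (group_word n) :=
  fun u v => `[< gen_cong (group_rel rels) u v >].

Lemma presented_rel_refl : reflexive presented_rel.
Proof. by move=> u; apply/asboolP; apply: GenCong_refl. Qed.

Lemma presented_rel_sym : symmetric presented_rel.
Proof. by move=> u v; apply/asboolP/asboolP; apply: GenCong_sym. Qed.

Lemma presented_rel_trans : transitive presented_rel.
Proof. by move=> v u w /asboolP uv /asboolP vw; apply/asboolP/(GenCong_trans uv). Qed.

Canonical presented_equiv :=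
  EquivRel presented_rel presented_rel_refl presented_rel_sym presented_rel_trans.

Definition presented_group := {eq_quot presented_rel}%qT.

HB.instance Definition _ := Choice.on presented_group.
HB.instance Definition _ := EqQuotient.on presented_group.

Local Notation P := presented_group.

Definition presented_pi (w : group_word n) : P := \pi_P w.

Local Notation pi := presented_pi.

Lemma presented_piP u v : pi u = pi v <-> gen_cong (group_rel rels) u v.
Proof.
split=> [/eqP|uv]; first by rewrite /pi eqmodE => /asboolP.
by apply/eqP; rewrite /pi eqmodE; apply/asboolP.
Qed.

Lemma presented_repr u : gen_cong (group_rel rels) (repr (pi u)) u.
Proof. by apply/presented_piP; rewrite /pi reprK. Qed.

Definition presented_mul (x y : P) : P := pi (repr x * repr y).

Lemma presented_piM u v : presented_mul (pi u) (pi v) = pi (u * v).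
Proof. by apply/presented_piP/GenCong_mul; apply: presented_repr. Qed.

Lemma presented_mulA : associative presented_mul.
Proof.
move=> x y z; rewrite -[x]reprK -[y]reprK -[z]reprK.
by rewrite -!/(pi _) !presented_piM mulgA.
Qed.

Lemma presented_mul1g : left_id (pi 1) presented_mul.
Proof. by move=> x; rewrite -[x]reprK -!/(pi _) presented_piM mul1g. Qed.

Lemma presented_mulg1 : right_id (pi 1) presented_mul.
Proof. by move=> x; rewrite -[x]reprK -!/(pi _) presented_piM mulg1. Qed.

HB.instance Definition _ :=
  isMonoid.Build P presented_mulA presented_mul1g presented_mulg1.

Lemma presented_pi_mul (u v : group_word n) : pi (u * v) = pi u * pi v.
Proof. exact/esym/presented_piM. Qed.

Lemma presented_pi1 : pi 1 = 1. Proof. by []. Qed.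

Definition word_inv (w : group_word n) : group_word n :=
  rev [seq (ib.1, ~~ ib.2) | ib <- w].

Lemma pi_letterV i b : pi (letter i (~~ b)) * pi (letter i b) = 1.
Proof.
rewrite -[b in X in _ * X]negbK -presented_pi_mul.
exact/presented_piP/GenCong_base/GroupRel_inv.
Qed.

Lemma pi_word_invl w : pi (word_inv w) * pi w = 1.
Proof.
elim: w => [|[i b] w IH]; first by rewrite mul1g.
have -> : word_inv ((i, b) :: w) = word_inv w * letter i (~~ b).
  by rewrite /word_inv /= rev_cons -cats1.
have -> : (i, b) :: w = letter i b * w :> group_word n by [].
by rewrite !presented_pi_mul -mulgA [X in _ * X]mulgA pi_letterV mul1g.
Qed.

Lemma word_invK : involutive word_inv.
Proof.
move=> w; rewrite /word_inv map_rev revK -map_comp -[RHS]map_id.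
by apply: eq_map => -[i b] /=; rewrite negbK.
Qed.

Definition presented_inv (x : P) : P := pi (word_inv (repr x)).

Lemma presented_mulVg : left_inverse 1 presented_inv *%g.
Proof. by move=> x; rewrite -[X in _ * X]reprK; apply: pi_word_invl. Qed.

Lemma presented_mulgV : right_inverse 1 presented_inv *%g.
Proof.
move=> x; rewrite -[X in X * _]reprK -/(pi _) -[repr x]word_invK.
exact: pi_word_invl.
Qed.

HB.instance Definition _ := hasInv.Build P presented_inv.
HB.instance Definition _ := Monoid_isGroup.Build P presented_mulVg presented_mulgV.

End PresentedGroup.

(** Injectivity is only asked modulo the relations in the presented group, so
    that it can be proved by computing there instead of deriving congruences. *)
Lemma fp_groupI (G : groupType) (n : nat) (rels : seq (group_word n * group_word n))
    (c : 'I_n -> G) :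
    (forall u v, (u, v) \in rels -> word_eval c u = word_eval c v) ->
    (forall g, exists w, word_eval c w = g) ->
    (forall u v, word_eval c u = word_eval c v ->
       presented_pi rels u = presented_pi rels v) ->
  fp_group G.
Proof.
move=> relP surj inj; exists n, rels, (word_eval c : {multiplicative _ -> _}); split.
  by apply/seteqP; split=> // g _; have [w <-] := surj g; exists w.
move=> u v; split=> [/inj|]; first exact: (presented_piP rels u v).1.
exact: word_eval_cong.
Qed.


(** * Words over the generators of a finitely presented semigroup *)

Section Words.
Variables (S : semigroupType) (A : choiceType).
Variable f : {multiplicative free_semigroup A -> S}.

Definition cons_word (a : A) (w : seq A) : free_semigroup A :=
  exist _ (a :: w : free_monoid A) isT.

Definition ev_letter (a : A) : adj1 S := to1 (f (cons_word a [::])).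

Definition ev (w : seq A) : adj1 S := foldr (fun a x => ev_letter a * x) 1 w.

Lemma ev_cons a w : ev (a :: w) = ev_letter a * ev w.
Proof. by []. Qed.

Lemma ev_cat u v : ev (u ++ v) = ev u * ev v.
Proof. by elim: u => [|a u IH] /=; rewrite ?mul1g// IH mulgA. Qed.

Lemma ev_val (w : free_semigroup A) : ev (val w) = to1 (f w).
Proof.
case: w => -[//|a w] wP /=; elim: w a wP => [|b w IH] a wP /=.
  by rewrite mulg1 /ev_letter; congr (to1 (f _)); apply: val_inj.
have wP' : (b :: w : free_monoid A) \in @nonempty_word A by [].
rewrite (IH b wP') /ev_letter -[LHS]/(to1 (_ * _)) -gmulfM.
by congr (to1 (f _)); apply: val_inj.
Qed.

Lemma ev_cons_word a w : ev (a :: w) = to1 (f (cons_word a w)).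
Proof. exact: (ev_val (cons_word a w)). Qed.

Lemma ev_surj : range f = setT -> forall x, exists w, ev w = x.
Proof.
move=> fsurj [t|]; last by exists [::].
have [w _ <-] : range f t by rewrite fsurj.
by exists (val w); rewrite ev_val.
Qed.

End Words.

Arguments ev : simpl never.

(** * The fundamental group of the quotient of a Schutzenberger graph *)

(** The set [V] of vertices stands for the copy of an R-class inside [S] with an
    identity adjoined: a subset that is convex and strongly connected under
    right multiplication.  [Q] indexes the orbits of [G] on [V]; outside of
    [V] the values of [cl] are arbitrary. *)
Section FreeAction.
Variables (S : semigroupType) (m : nat).
Variable rels : seq (free_semigroup 'I_m * free_semigroup 'I_m).
Variable f : {multiplicative free_semigroup 'I_m -> S}.
Hypothesis fP : induces_iso (fun u v => (u, v) \in rels) f.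

Variables (V : adj1 S -> Prop) (s : S).
Hypothesis Vs : V (to1 s).
Hypothesis V_prefix : forall x y z, V x -> V (x * y * z) -> V (x * y).
Hypothesis V_connected : forall x y, V x -> V y -> exists z, x * z = y.
Hypothesis s_stab : no_nontrivial_hom_to_group (Str s).

Variables (G : groupType) (act : G -> adj1 S -> adj1 S).
Hypothesis actV : forall g x, V x -> V (act g x).
Hypothesis act_mulr : forall g x y, act g (x * y) = act g x * y.
Hypothesis act1 : forall x, V x -> act 1 x = x.
Hypothesis act_comp : forall g h x, V x -> act (g * h) x = act g (act h x).
Hypothesis act_free : forall g h x, V x -> act g x = act h x -> g = h.

Variables (Q : finType) (cl : adj1 S -> Q).
Hypothesis clP : forall x y, V x -> V y -> cl x = cl y <-> exists g, y = act g x.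

Local Notation ev := (ev f).
Local Notation ev_letter := (ev_letter f).
Local Notation n := #|{: Q * 'I_m}|.

Definition edge (q : Q) (a : 'I_m) : 'I_n := enum_rank (q, a).

(** The image in the quotient graph of the path labelled [w] that starts at [x]. *)
Fixpoint path_word (x : adj1 S) (w : seq 'I_m) : group_word n :=
  if w is a :: w' then letter (edge (cl x) a) true * path_word (x * ev_letter a) w'
  else 1.

Arguments path_word : simpl never.

Lemma path_word_cons x a w : path_word x (a :: w) =
  letter (edge (cl x) a) true * path_word (x * ev_letter a) w.
Proof. by []. Qed.

Lemma path_word_cat x u v :
  path_word x (u ++ v) = path_word x u * path_word (x * ev u) v.
Proof.
elim: u x => [|a u IH] x; first by rewrite mul1g mulg1.
by rewrite cat_cons !path_word_cons IH ev_cons !mulgA.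
Qed.

Lemma cl_act g x : V x -> cl (act g x) = cl x.
Proof. by move=> Vx; apply/esym/clP => //; [apply: actV | exists g]. Qed.

(** Translates of a path have the same image in the quotient graph. *)
Lemma path_word_act g x w : V x -> V (x * ev w) ->
  path_word (act g x) w = path_word x w.
Proof.
elim: w x => [//|a w IH] x Vx; rewrite ev_cons mulgA => Vxaw.
have Vxa := V_prefix Vx Vxaw.
by rewrite !path_word_cons cl_act// -act_mulr IH.
Qed.

(** Choices that trivialize the covering: a vertex [rep q] in each orbit, the
    coordinate [coef x] in [G] of each vertex [x], and a path from the base
    vertex [s] to each [rep q]. *)
Section Presentation.
Variables (rep : Q -> adj1 S) (coef : adj1 S -> G) (base_path : Q -> seq 'I_m).
Hypothesis repV : forall q, V (rep q).
Hypothesis repK : forall q, cl (rep q) = q.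
Hypothesis rep_base : rep (cl (to1 s)) = to1 s.
Hypothesis coefP : forall x, V x -> x = act (coef x) (rep (cl x)).
Hypothesis base_pathP : forall q, to1 s * ev (base_path q) = rep q.

(** The three families of relations are the images of the 2-cells, the
    contraction of the base paths, which plays the role of a spanning tree, and
    the removal of the pairs (orbit, letter) that are not edges because
    multiplying by the letter leaves [V]. *)
Definition presentation : seq (group_word n * group_word n) :=
  [seq (path_word (rep q) (val uv.1), path_word (rep q) (val uv.2))
     | q <- enum Q, uv <- [seq uv <- rels | `[< V (rep q * to1 (f uv.1)) >]]]
  ++ [seq (path_word (to1 s) (base_path q), 1) | q <- enum Q]
  ++ [seq (letter (edge q a) true, 1)
        | q <- enum Q, a <- [seq a <- enum 'I_m | `[< ~ V (rep q * ev_letter a) >]]].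

(** The edge [(q, a)] lifts to one from [rep q], of coordinate 1, to
    [rep q * ev_letter a]; its label is the coordinate of that end. *)
Definition edge_label (i : 'I_n) : G :=
  let: (q, a) := enum_val i in
  if `[< V (rep q * ev_letter a) >] then coef (rep q * ev_letter a) else 1.

Local Notation phi := (word_eval edge_label).
Local Notation pi := (presented_pi presentation).

Lemma coef_act g x : V x -> coef (act g x) = g * coef x.
Proof.
move=> Vx; apply: (@act_free _ _ (rep (cl x))) => //.
by rewrite act_comp// -coefP// -(cl_act g Vx) -coefP//; apply: actV.
Qed.

Lemma coef_rep q : coef (rep q) = 1.
Proof.
apply: (@act_free _ _ (rep q)) => //.
by rewrite -[X in act _ (rep X)](repK q) -coefP// act1.
Qed.

Lemma V_rep x y : V x -> V (x * y) -> V (rep (cl x) * y).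
Proof.
move=> Vx Vxy; suff -> : rep (cl x) = act (coef x)^-1 x.
  by rewrite -act_mulr; apply: actV.
by rewrite [X in act _ X](coefP Vx) -act_comp// mulVg act1.
Qed.

(** Unique path lifting: along a path the coordinate is multiplied on the right
    by the label of the path, because the action commutes with [S]. *)
Lemma coef_path x w : V x -> V (x * ev w) ->
  coef (x * ev w) = coef x * phi (path_word x w).
Proof.
elim: w x => [|a w IH] x Vx; first by rewrite !mulg1.
rewrite ev_cons path_word_cons mulgA => Vxaw; have Vxa := V_prefix Vx Vxaw.
rewrite IH// word_evalM mulgA word_eval_letter; congr (_ * _).
have xa : x * ev_letter a = act (coef x) (rep (cl x) * ev_letter a).
  by rewrite act_mulr -coefP.
have Vra := V_rep Vx Vxa.
rewrite {1}xa coef_act// /letter_eval/= /edge_label enum_rankK.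
by case: asboolP.
Qed.

Lemma presentation_phi u v : (u, v) \in presentation -> phi u = phi v.
Proof.
rewrite !mem_cat => /or3P[|/mapP[q _ [-> ->]]|].
- case/allpairsPdep=> q [[u1 v1] [_]].
  rewrite mem_filter => /andP[/asboolP Vu uv1] [-> ->] /=.
  have uv : f u1 = f v1 by apply/fP.2/GenCong_base.
  apply: (mulgI (coef (rep q))).
  have [Vu' Vv'] : V (rep q * ev (val u1)) /\ V (rep q * ev (val v1)).
    by rewrite !ev_val -uv.
  by rewrite -!coef_path// !ev_val uv.
- apply: (mulgI (coef (to1 s))).
  transitivity (coef (to1 s * ev (base_path q))).
    by rewrite coef_path ?base_pathP.
  by rewrite base_pathP -[phi 1]/1 mulg1 coef_rep -rep_base coef_rep.
case/allpairsPdep=> q [a [_]]; rewrite mem_filter => /andP[/asboolP nV _] [-> ->].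
by rewrite word_eval_letter /letter_eval/= /edge_label enum_rankK; case: asboolP.
Qed.

Lemma pi_base_path q : pi (path_word (to1 s) (base_path q)) = 1.
Proof.
rewrite -(presented_pi1 presentation); apply/presented_piP/GenCong_base/GroupRel_given.
by rewrite !mem_cat; apply/or3P/Or32/mapP; exists q; rewrite ?mem_enum.
Qed.

(** Equal words are homotopic.  For a defining relation this is a 2-cell, after
    translating [x] to its orbit representative; all vertices along the
    path lie in [V] by convexity, so the induction goes through. *)
Lemma pi_path_cong (u v : free_semigroup 'I_m) x : f u = f v -> V x ->
    V (x * to1 (f u)) ->
  pi (path_word x (val u)) = pi (path_word x (val v)).
Proof.
move=> /fP.2 uv; elim: uv x => {u v}
  [u v uv|u|u v uv IH|u v w uv IH1 vw IH2|u u' v v' uu' IH1 vv' IH2] x Vx.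
- move=> Vxu; have xE := coefP Vx; have Vru := V_rep Vx Vxu.
  have Vrv : V (rep (cl x) * to1 (f v)).
    by rewrite -(fP.2 u v).2 //; exact: GenCong_base.
  rewrite xE !path_word_act ?ev_val//.
  apply/presented_piP/GenCong_base/GroupRel_given; rewrite mem_cat; apply/orP; left.
  apply/allpairsPdep; exists (cl x), (u, v).
  by rewrite mem_enum mem_filter uv andbT; split=> //; apply/asboolP.
- by [].
- by move=> Vxv; rewrite IH// (fP.2 u v).2.
- by move=> Vxu; rewrite IH1// IH2// -(fP.2 u v).2.
rewrite gmulfM -[to1 (f u * f v)]/(to1 (f u) * to1 (f v)) mulgA => Vxuv.
have Vxu := V_prefix Vx Vxuv.
rewrite !path_word_cat !presented_pi_mul !ev_val IH1// IH2//.
by rewrite (fP.2 u u').2.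
Qed.

(** The homotopy class of a loop at [s] whose label has value [t] in [S]; by
    [pi_path_eq] the choice of the label is irrelevant. *)
Definition stab_label (t : Str s) : presented_group presentation :=
  pi (path_word (to1 s) (sval (cid (ev_surj fP.1 (to1 (val t)))))).

Lemma pi_path_eq u v x : ev u = ev v -> V x -> V (x * ev u) ->
  pi (path_word x u) = pi (path_word x v).
Proof.
case: u v => [|a u] [|b v]; rewrite ?ev_cons_word // => -[uv] Vx Vxu.
exact: (pi_path_cong uv).
Qed.

Lemma stab_labelM t t' : stab_label (t * t') = stab_label t * stab_label t'.
Proof.
rewrite /stab_label; case: cid => w /= wE; case: cid => u /= uE; case: cid => v /= vE.
have su : to1 s * ev u = to1 s.
  by rewrite uE -[LHS]/(to1 (s * val t)); have /eqP -> := valP t.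
have sv : to1 s * ev v = to1 s.
  by rewrite vE -[LHS]/(to1 (s * val t')); have /eqP -> := valP t'.
have e : ev w = ev (u ++ v) by rewrite wE ev_cat uE vE.
rewrite (pi_path_eq e) ?path_word_cat ?presented_pi_mul ?su//.
by rewrite e ev_cat mulgA su sv.
Qed.

HB.instance Definition _ :=
  isMultiplicative.Build (Str s) (presented_group presentation) stab_label stab_labelM.

Lemma stab_label1 t : stab_label t = 1.
Proof.
have := @s_stab _ (stab_label : {multiplicative _ -> _}).
move=> /(_ (stab_label t) (stab_label (t * t))) e.
apply: (mulgI (stab_label t)); rewrite -stab_labelM mulg1.
by apply/esym/e; [exists t | exists (t * t)].
Qed.

(** Directed loops at [s] are null-homotopic. *)
Lemma pi_loop w : to1 s * ev w = to1 s -> pi (path_word (to1 s) w) = 1.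
Proof.
case: w => [|a w] sw; first exact: presented_pi1.
pose t := f (cons_word a w); have ewt : ev (a :: w) = to1 t by exact: ev_cons_word.
have st : t \in rstab s by apply/eqP; move: sw; rewrite ewt => -[].
rewrite -(stab_label1 (exist _ t st)) /stab_label; case: cid => v /= vE.
by apply: pi_path_eq => //; rewrite ?sw// vE.
Qed.

(** Closing both paths by the same path back to [s] gives two loops, and in a
    group the common factor cancels. *)
Lemma pi_path_end u v : V (to1 s * ev u) -> to1 s * ev u = to1 s * ev v ->
  pi (path_word (to1 s) u) = pi (path_word (to1 s) v).
Proof.
move=> Vsu suv; have [z sz] := V_connected Vsu Vs.
have [w wz] := ev_surj fP.1 z.
apply: (mulIg (pi (path_word (to1 s * ev u) w))).
rewrite {2}suv -!presented_pi_mul -!path_word_cat.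
by rewrite !pi_loop// ev_cat mulgA wz -?suv.
Qed.

(** The directed path [w] from [s] lifts the element [p] of the group. *)
Definition represents w p :=
  to1 s * ev w = act (phi p) (to1 s) /\ pi (path_word (to1 s) w) = pi p.

Lemma representsM u v p q : represents u p -> represents v q ->
  represents (u ++ v) (p * q).
Proof.
move=> [su pu] [sv pv]; have Vsv : V (to1 s * ev v) by rewrite sv; apply: actV.
split; first by rewrite ev_cat mulgA su -act_mulr sv -act_comp// word_evalM.
by rewrite path_word_cat su path_word_act// !presented_pi_mul pu pv.
Qed.

Lemma represents1 : represents [::] 1.
Proof. by split=> //; rewrite mulg1 act1. Qed.

(** An edge [(q, a)] is lifted by going from [s] to [rep q], along [a], and then
    back to the orbit of [s] by a path that returns from [rep q'] to [s]; that
    last path is trivial since the base path to [q'] followed by it is a loop. *)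
Lemma represents_edge i : exists w, represents w (letter i true).
Proof.
rewrite /represents word_eval_letter -[i]enum_valK; case: (enum_val i) => q a {i}.
rewrite /letter_eval/= /edge_label enum_rankK; case: asboolP => [Va|nV].
  set x := rep q * ev_letter a; set q' := cl x.
  have xE : x = act (coef x) (rep q') by exact: coefP.
  have [z ez] := V_connected (repV q') Vs; have [w wz] := ev_surj fP.1 z; subst z.
  exists (base_path q ++ a :: w); split.
    rewrite ev_cat ev_cons !mulgA base_pathP.
    by rewrite -/x {1}xE -act_mulr ez.
  rewrite path_word_cat base_pathP path_word_cons repK !presented_pi_mul.
  have -> : pi (path_word (to1 s) (base_path q)) = 1.
    exact: pi_base_path.
  rewrite mul1g -/x {1}xE path_word_act//; last by rewrite ez.
  have : pi (path_word (to1 s) (base_path q' ++ w)) = 1.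
    by apply: pi_loop; rewrite ev_cat mulgA base_pathP.
  by rewrite path_word_cat base_pathP presented_pi_mul pi_base_path mul1g => ->;
    rewrite mulg1.
exists [::]; rewrite mulg1 act1//; split=> //.
apply/esym/presented_piP/GenCong_base/GroupRel_given; rewrite !mem_cat; apply/or3P/Or33.
apply/allpairsPdep; exists q, a; rewrite mem_enum mem_filter mem_enum andbT.
by split=> //; apply/asboolP.
Qed.

(** Strong connectedness replaces an inverse edge by a directed path. *)
Lemma represents_edgeV i : exists w, represents w (letter i false).
Proof.
have [u [su pu]] := represents_edge i.
set g := phi (letter i true) in su.
have gV : phi (letter i false) = g^-1.
  by rewrite /g !word_eval_letter.
have [z ez] := V_connected Vs (actV g^-1 Vs); have [w wz] := ev_surj fP.1 z; subst z.
exists w; split; first by rewrite ez gV.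
apply: (mulgI (pi (letter i true))); rewrite (pi_letterV _ i false) -pu.
have Vsw : V (to1 s * ev w) by rewrite ez; apply: actV.
rewrite -(path_word_act g Vs Vsw).
rewrite -su -presented_pi_mul -path_word_cat pi_loop//.
by rewrite ev_cat mulgA su -act_mulr ez -act_comp// mulgV act1.
Qed.

Lemma represents_ex p : exists w, represents w p.
Proof.
elim: p => [|[i b] p [v pv]]; first by exists [::]; exact: represents1.
have [u pu] : exists u, represents u (letter i b).
  by case: b; [apply: represents_edge | apply: represents_edgeV].
by exists (u ++ v); apply: (representsM pu pv).
Qed.

Lemma fp_of_choices : fp_group G.
Proof.
apply: (@fp_groupI _ _ presentation edge_label) => [|g|p q pq].
- exact: presentation_phi.
- have [z ez] := V_connected Vs (actV g Vs); have [w wz] := ev_surj fP.1 z; subst z.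
  exists (path_word (to1 s) w).
  have c1 : coef (to1 s) = 1 by rewrite -rep_base coef_rep.
  have := coef_path Vs; move=> /(_ w); rewrite ez c1 mul1g => <-; last exact: actV.
  by rewrite coef_act// c1 mulg1.
have [u [su <-]] := represents_ex p; have [v [sv <-]] := represents_ex q.
by apply: pi_path_end; rewrite su ?sv ?pq//; apply: actV.
Qed.

End Presentation.

(** [rep] is chosen to send the orbit of [s] to [s] itself, which makes the
    coordinate of [s] equal to 1. *)
Lemma fp_of_free_action :
  (forall q, exists2 x, V x & cl x = q) -> fp_group G.
Proof.
move=> cl_surj.
have /choice[rep repP] q : exists x, [/\ V x, cl x = q & q = cl (to1 s) -> x = to1 s].
  have [-> | ne] := eqVneq q (cl (to1 s)); first by exists (to1 s).
  by have [x Vx xq] := cl_surj q; exists x; split=> // e; rewrite e eqxx in ne.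
have repV q : V (rep q) by case: (repP q).
have repK q : cl (rep q) = q by case: (repP q).
have rep_base : rep (cl (to1 s)) = to1 s by case: (repP (cl (to1 s))) => _ _ ->.
have /choice[coef coefP] x : exists g, V x -> x = act g (rep (cl x)).
  have [Vx|nV] := pselect (V x); last by exists 1.
  have /clP[//|//|g e] : cl (rep (cl x)) = cl x by [].
  by exists g.
have /choice[base_path base_pathP] q : exists w, to1 s * ev w = rep q.
  have [z <-] := V_connected Vs (repV q); have [w <-] := ev_surj fP.1 z.
  by exists w.
exact: (fp_of_choices repV repK rep_base coefP base_pathP).
Qed.

End FreeAction.

(** * The action of the Schutzenberger group on its class *)

Section RclassAction.
Variables (S : semigroupType) (R : set S).
Hypotheses (hR : is_Rclass R) (hfin : finite_set (Hclasses_in R)).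

Local Notation G := (schutz_group hR hfin).

Definition in_R1 (x : adj1 S) : Prop := exists2 r, R r & x = to1 r.

Lemma R1_prefix (x y z : adj1 S) : in_R1 x -> in_R1 (x * y * z) -> in_R1 (x * y).
Proof.
case=> r Rr -> [t Rt ryz].
have [v vE] : exists v, to1 r * y = to1 v.
  by case: (y) => [y'|]; [exists (r * y') | exists r].
exists v => //; apply/(RclassP hR _ Rr); rewrite -vE; split; last by exists y.
have [[a ra] _] := (RclassP hR _ Rr).1 Rt.
by exists (z * a); rewrite mulgA ryz -ra.
Qed.

Lemma R1_connected (x y : adj1 S) : in_R1 x -> in_R1 y -> exists z, x * z = y.
Proof.
by case=> r Rr -> [t Rt ->]; have [_ [z ->]] := (RclassP hR _ Rr).1 Rt; exists z.
Qed.

Definition schutz_act (g : G) (x : adj1 S) : adj1 S :=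
  val (repr (g : schutz_monoid R)) * x.

Lemma schutz_act_pi (u : St R) x : in_R1 x ->
  schutz_act (\pi_(schutz_monoid R) u) x = val u * x.
Proof. by case=> r Rr ->; apply: repr_pi. Qed.

Lemma schutz_actV g x : in_R1 x -> in_R1 (schutz_act g x).
Proof. by case=> r Rr ->; apply/stabP: Rr; apply: valP. Qed.

Lemma schutz_act_mulr g x y : schutz_act g (x * y) = schutz_act g x * y.
Proof. exact: mulgA. Qed.

Lemma schutz_act1 x : in_R1 x -> schutz_act 1 x = x.
Proof. by move=> Vx; rewrite [LHS]schutz_act_pi// gmulf1 mul1g. Qed.

Lemma schutz_act_comp g h x : in_R1 x ->
  schutz_act (g * h) x = schutz_act g (schutz_act h x).
Proof. by move=> Vx; rewrite [LHS]schutz_act_pi// gmulfM -mulgA. Qed.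

(** If [ur = vr] then [u] and [v] agree on [rS], hence on all of [R]. *)
Lemma schutz_act_free g h x : in_R1 x -> schutz_act g x = schutz_act h x -> g = h.
Proof.
case=> r Rr -> e.
suff : \pi_(schutz_monoid R) (repr (g : schutz_monoid R))
     = \pi_(schutz_monoid R) (repr (h : schutz_monoid R)) by rewrite !reprK.
apply/eqP/Defs.piP => t Rt; have [_ [c ->]] := (RclassP hR _ Rr).1 Rt.
by rewrite !mulgA; congr (_ * c).
Qed.

Lemma greenLP (s t : S) : greenL s t <->
  (exists a : adj1 S, to1 s = a * to1 t) /\ (exists b : adj1 S, to1 t = b * to1 s).
Proof.
split=> [e|[[a ea] [b eb]]].
  split.
    have : range (fun x : adj1 S => x * to1 s) (to1 s) by exists 1; rewrite ?mul1g.
    by rewrite e => -[a _ <-]; exists a.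
  have : range (fun x : adj1 S => x * to1 t) (to1 t) by exists 1; rewrite ?mul1g.
  by rewrite -e => -[a _ <-]; exists a.
apply/seteqP; split=> _ [x _ <-].
  by exists (x * a) => //; rewrite -mulgA -ea.
by exists (x * b) => //; rewrite -mulgA -eb.
Qed.

Lemma Rclass_greenR (r t : S) : R r -> R t -> greenR r t.
Proof. by move=> Rr /(RclassP hR _ Rr) rt; apply/greenRP. Qed.

(** An element [b] with [t = br], [t] and [r] in [R], stabilizes [R]: if
    [r' = rd] then [br' = td], and multiplying [td] on the right by what takes
    [r'] back to [r] gives [t] again. *)
Lemma greenH_orbitP (r t : S) : R r -> R t ->
  greenH r t <-> exists g, to1 t = schutz_act g (to1 r).
Proof.
move=> Rr Rt; split=> [[/greenLP[_ [b tb]] _]|[g tg]].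
  have bS : b \in stab R.
    apply/stabP => r' Rr'; have [[c rc] [d r'd]] := (RclassP hR _ Rr).1 Rr'.
    have [v vE] : exists v, to1 t * d = to1 v.
      by case: (d) => [d'|]; [exists (t * d') | exists t].
    exists v; last by rewrite -vE r'd mulgA -tb.
    apply/(RclassP hR _ Rt); rewrite -vE; split; last by exists d.
    by exists c; rewrite tb -!mulgA [_ * (d * c)]mulgA -r'd -rc.
  exists (\pi_(schutz_monoid R) (exist _ b bS)).
  by rewrite schutz_act_pi//; exists r.
split; last exact: Rclass_greenR.
apply/greenLP; split; last by exists (val (repr (g : schutz_monoid R))).
exists (val (repr (g^-1 : schutz_monoid R))).
rewrite tg -[RHS]schutz_act_comp ?mulVg ?schutz_act1//; by exists r.
Qed.

Lemma Hclass_eqP (r t : S) :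
  [set u | greenH r u] = [set u | greenH t u] <-> greenH r t.
Proof.
split=> [e|[eL eR]]; first by have : [set u | greenH t u] t by []; rewrite -e.
by apply/seteqP; split=> u []; rewrite /= /greenH /greenL /greenR eL eR.
Qed.

Lemma finitely_many_orbits : exists (Q : finType) (cl : adj1 S -> Q),
  (forall x y, in_R1 x -> in_R1 y ->
     cl x = cl y <-> exists g, y = schutz_act g x) /\
  (forall q, exists2 x, in_R1 x & cl x = q).
Proof.
have [s0 Rs0] : exists s, R s by case: hR => s ->; exists s.
have /finite_seqP[hs hsE] := hfin.
pose H (x : adj1 S) : set S := if x is Some r then [set t | greenH r t] else set0.
have Hhs r : R r -> H (to1 r) \in hs.
  move=> Rr; have : Hclasses_in R (H (to1 r)) by exists r.
  by rewrite hsE.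
pose cl x : seq_sub hs := insubd (SeqSub (Hhs s0 Rs0)) (H x).
have clE r : R r -> ssval (cl (to1 r)) = H (to1 r).
  by move=> Rr; apply: insubdK; exact: (Hhs _ Rr).
exists (seq_sub hs), cl; split=> [x y [r Rr ->] [t Rt ->]|q].
  rewrite -(greenH_orbitP Rr Rt) -Hclass_eqP; split=> [e|e].
    by have := clE _ Rr; rewrite e clE.
  by apply: val_inj; rewrite /= !clE.
have : Hclasses_in R (ssval q) by rewrite hsE; apply: ssvalP.
by case=> r Rr qr; exists (to1 r); [exists r | apply: val_inj; rewrite /= clE].
Qed.

End RclassAction.

(** * Finite presentability *)

Theorem theorem1p1 (S : semigroupType) (R : set S)
  (hS : fp_semigroup S)
  (hR : is_Rclass R)
  (hfin : finite_set (Hclasses_in R))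
  (hst : exists2 s : S, R s & no_nontrivial_hom_to_group (Str s)) :
  fp_group (schutz_group hR hfin).
Proof.
have [m [rels [f fP]]] := hS; have [s Rs s_stab] := hst.
have [Q [cl [clP cl_surj]]] := finitely_many_orbits hR hfin.
have Vs : in_R1 R (to1 s) by exists s.
exact: (fp_of_free_action fP Vs (R1_prefix hR) (R1_connected hR) s_stab
  (@schutz_actV _ _ hR hfin) (@schutz_act_mulr _ _ hR hfin) (@schutz_act1 _ _ hR hfin)
  (@schutz_act_comp _ _ hR hfin) (@schutz_act_free _ _ hR hfin) clP cl_surj).
Qed.
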